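(* Let $\pi\colon X\to Y$ be a factor map between actions of a countable amenable group $G$ on compact metrizable spaces. The following statements are equivalent. (i) $\pi$ is equicontinuous. (ii) $\pi$ is mean equicontinuous and distal. (iii) $\pi$ is mean equicontinuous and Banach distal.
   Context: $G$ is a countable (discrete) amenable group; a Følner sequence is a sequence $(F_n)$ of nonempty finite subsets of $G$ with $|F_n\Delta gF_n|/|F_n|\to 0$ for all $g\in G$. An action $X$ of $G$ is a compact metrizable space $X$ with a homomorphism from $G$ to the homeomorphisms of $X$, written $(g,x)\mapsto g.x$; $d$ denotes a metric inducing the topology of $X$ (the notions below do not depend on its choice). A factor map $\pi\colon X\to Y$ is a continuous surjection with $\pi(g.x)=g.\pi(x)$ for all $g\in G$, $x\in X$, and $R(\pi):=\{(x,x')\in X^2;\ \pi(x)=\pi(x')\}$. The Weyl pseudometric is $D(x,x'):=\sup_{(F_n)}\limsup_{n\to\infty}\frac1{|F_n|}\sum_{g\in F_n}d(g.x,g.x')$, the supremum being over all Følner sequences. A pair $(x,x')$ is Banach proximal if $D(x,x')=0$; a sequence $(x_n,x_n')$ in $X^2$ is asymptotically Banach proximal if $D(x_n,x_n')\to0$. The factor map $\pi$ is mean equicontinuous if for every convergent sequence in $R(\pi)$ the sequence is asymptotically Banach proximal if and only if its limit is Banach proximal. It is Banach distal if every $(x,x')\in R(\pi)$ with $x\neq x'$ satisfies $D(x,x')>0$. $\pi$ is distal if every $(x,x')\in R(\pi)$ with $x\ne x'$ satisfies $\inf_{g\in G}d(g.x,g.x')>0$. $\pi$ is equicontinuous if for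 all $\epsilon>0$ there is $\delta>0$ such that all $(x,x')\in R(\pi)$ with $d(x,x')<\delta$ satisfy $\sup_{g\in G}d(g.x,g.x')<\epsilon$. *)

(* Defs.v *)
(* A group is a [groupType] (possibly infinite), a finite
   subset of it is a [{fset G}], and a compact metrizable space with a chosen
   compatible metric is a [metricType R] whose full set is compact. *)
From HB Require Import structures.
From mathcomp Require Import all_boot all_order all_algebra finmap.
From mathcomp Require Import all_classical all_reals all_analysis.

Set Implicit Arguments.
Unset Strict Implicit.
Unset Printing Implicit Defensive.

Import Order.TTheory GRing.Theory Num.Theory.
Import numFieldNormedType.Exports.

Local Open Scope classical_set_scope.
Local Open Scope ring_scope.

Section Folner.
Variables (R : realType) (G : groupType).

Definition ltranslate (g : G) (A : {fset G}) : {fset G} :=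
  [fset (g * h)%g | h in A]%fset.

Definition fset_symdiff (A B : {fset G}) : {fset G} :=
  ((A `\` B) `|` (B `\` A))%fset.

Definition folner (F : nat -> {fset G}) : Prop :=
  (forall n, F n != fset0) /\
  (forall g : G,
     (#|` fset_symdiff (F n) (ltranslate g (F n))|%:R / #|` F n|%:R : R)
       @[n --> \oo] --> (0 : R)).

(* For countable groups, amenability is the existence of a Folner sequence;
   the notion does not depend on [R]. *)
Definition amenable : Prop := exists F : nat -> {fset G}, folner F.

End Folner.

(* Each [a g] is then a homeomorphism, with inverse [a g^-1]. *)
Record continuous_action (G : groupType) (X : topologicalType)
    (a : G -> X -> X) : Prop := ContinuousAction {
  continuous_action1 : forall x, a 1%g x = x;
  continuous_actionM : forall g h x, a (g * h)%g x = a g (a h x);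
  continuous_action_continuous : forall g, continuous (a g)
}.

Record factor_map (G : groupType) (X Y : topologicalType)
    (a : G -> X -> X) (b : G -> Y -> Y) (pi : X -> Y) : Prop := FactorMap {
  factor_map_continuous : continuous pi;
  factor_map_surj : forall y, exists x, pi x = y;
  factor_map_equivariant : forall g x, pi (a g x) = b g (pi x)
}.

Section FactorMaps.
Variables (R : realType) (G : groupType) (X : metricType R) (Y : Type).
Variables (a : G -> X -> X) (pi : X -> Y).

Definition fiber_rel : set (X * X) := [set p | pi p.1 = pi p.2].

Definition folner_average (A : {fset G}) (x x' : X) : R :=
  (#|` A|%:R)^-1 * \sum_(g <- A) mdist (a g x) (a g x').

Definition weyl (x x' : X) : \bar R :=
  ereal_sup [set limn_esup (fun n => (folner_average (F n) x x')%:E)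
            | F in [set F : nat -> {fset G} | folner R F]].

Definition banach_proximal (p : X * X) : Prop := weyl p.1 p.2 = 0%E.

Definition asymptotically_banach_proximal (u : nat -> X * X) : Prop :=
  weyl (u n).1 (u n).2 @[n --> \oo] --> 0%E.

Definition mean_equicontinuous : Prop :=
  forall (u : nat -> X * X) (l : X * X),
    (forall n, fiber_rel (u n)) -> u n @[n --> \oo] --> l ->
    (asymptotically_banach_proximal u <-> banach_proximal l).

Definition banach_distal : Prop :=
  forall x x' : X, fiber_rel (x, x') -> x <> x' -> (0 < weyl x x')%E.

Definition distal : Prop :=
  forall x x' : X, fiber_rel (x, x') -> x <> x' ->
    (0 < ereal_inf [set (mdist (a g x) (a g x'))%:E | g in [set: G]])%E.

Definition equicontinuous_factor : Prop :=
  forall eps : R, 0 < eps -> exists2 delta : R, 0 < delta &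
    forall x x' : X, fiber_rel (x, x') -> mdist x x' < delta ->
      (ereal_sup [set (mdist (a g x) (a g x'))%:E | g in [set: G]] < eps%:E)%E.

End FactorMaps.

(* Main.v *)
Require Import Defs.
From HB Require Import structures.
From mathcomp Require Import all_boot all_order all_algebra finmap.
From mathcomp Require Import all_classical all_reals all_analysis.
From mathcomp Require Import lra.

(** On the fibres of an equicontinuous factor map a pair which comes close at
    one time was close from the start, because returning to time zero is again
    one of the uniformly controlled motions.  The Weyl pseudometric lies
    between the infimum and the supremum of the distance along the orbit, so
    for sequences of fibre pairs the three conditions [D -> 0], [d -> 0] and
    <<the limit is on the diagonal>> coincide
    ([equicontinuous_asymptotically_banach_proximalE]); this is mean
    equicontinuity, and distality follows in the same way.

    Distal implies Banach distal because the infimum of the distance along the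
    orbit is a lower bound for [D].

    For the way back, a failure of equicontinuity gives fibre pairs [u n] whose
    distance tends to zero and times [g n] at which they are at distance at
    least [eps].  By compactness both [u n] and [g n . u n] may be assumed to
    converge.  The limit of [u n] is on the diagonal, so mean equicontinuity
    gives [D (u n) -> 0].  The crucial point is that [D] is invariant under the
    action ([weyl_invariant]): right translates of a Folner sequence are again
    Folner.  Hence [D (g n . u n) -> 0] too, and mean equicontinuity makes the
    limit of [g n . u n] Banach proximal; Banach distality puts it on the
    diagonal, although its two points are at distance at least [eps]. *)

Set Implicit Arguments.
Unset Strict Implicit.
Unset Printing Implicit Defensive.

Import Order.TTheory GRing.Theory Num.Theory.
Import numFieldNormedType.Exports.

Local Open Scope classical_set_scope.
Local Open Scope ring_scope.

(** * Sequences in compact metric spaces *)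

Lemma compact_cvg_extraction (R : realType) (T : pseudoMetricType R)
    (w : nat -> T) : compact [set: T] ->
  exists (n : nat -> nat) (p : T),
    (forall k, (k <= n k)%N) /\ w (n k) @[k --> \oo] --> p.
Proof.
move=> cT.
have [p [_ clp]] := cT (w @ \oo) _ filterT.
have near_p k : exists m, (k <= m)%N /\ ball p k.+1%:R^-1 (w m).
  have wk : (w @ \oo) (w @` [set m | (k <= m)%N]).
    by exists k => // m km; exists m.
  have bk : nbhs p (ball p k.+1%:R^-1) by apply: nbhsx_ballx; rewrite invr_gt0.
  by have [_ [[m km <-] bm]] := clp _ _ wk bk; exists m.
have [n nP] := choice near_p.
exists n, p; split=> [k|]; first by have [] := nP k.
apply/cvg_ballP => e e0; near=> k.
apply: le_ball (nP k).2; apply: ltW.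
by near: k; exact: near_infty_natSinv_lt (PosNum e0).
Unshelve. all: by end_near. Qed.

Lemma mdist_cvg (R : realType) (X : metricType R) (u : nat -> X * X)
    (l : X * X) : u n @[n --> \oo] --> l ->
  (mdist (u n).1 (u n).2 : R) @[n --> \oo] --> mdist l.1 l.2.
Proof.
move=> ul; apply/cvgrPdist_le => e e0.
have u1 : (u n).1 @[n --> \oo] --> l.1 by exact: cvg_comp ul cvg_fst.
have u2 : (u n).2 @[n --> \oo] --> l.2 by exact: cvg_comp ul cvg_snd.
have e20 : 0 < e / 2 by rewrite divr_gt0.
near=> n.
have d1 : mdist l.1 (u n).1 <= e / 2.
  by near: n; exact: metricType_numDomainType.cvgr_dist_le.
have d2 : mdist l.2 (u n).2 <= e / 2.
  by near: n; exact: metricType_numDomainType.cvgr_dist_le.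
have t1 := metric_triangle l.1 (u n).1 l.2.
have t2 := metric_triangle (u n).1 (u n).2 l.2.
have t3 := metric_triangle (u n).1 l.1 (u n).2.
have t4 := metric_triangle l.1 l.2 (u n).2.
have s1 := metric_sym l.1 (u n).1.
have s2 := metric_sym l.2 (u n).2.
by rewrite ler_norml; apply/andP; split; lra.
Unshelve. all: by end_near. Qed.

Lemma mdist_cvg0_diag (R : realType) (X : metricType R) (u : nat -> X * X)
    (l : X * X) : u n @[n --> \oo] --> l ->
  (mdist (u n).1 (u n).2 : R) @[n --> \oo] --> (0 : R) <-> l.1 = l.2.
Proof.
move=> /mdist_cvg ul; split=> [u0|l12]; last by rewrite l12 mdistxx in ul.
apply: mdist_positivity.
by rewrite -(cvg_lim _ ul)// (cvg_lim _ u0).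
Qed.

Lemma fiber_rel_cvg (R : realType) (X Y : metricType R) (pi : X -> Y)
    (u : nat -> X * X) (l : X * X) : continuous pi ->
  (forall n, fiber_rel pi (u n)) -> u n @[n --> \oo] --> l -> fiber_rel pi l.
Proof.
move=> cpi fu ul.
have u1 : pi (u n).1 @[n --> \oo] --> pi l.1.
  by apply: continuous_cvg; [exact: cpi|exact: cvg_comp ul cvg_fst].
have u2 : pi (u n).2 @[n --> \oo] --> pi l.2.
  by apply: continuous_cvg; [exact: cpi|exact: cvg_comp ul cvg_snd].
apply: (cvg_unique (@metric_hausdorff _ Y) u1).
by rewrite (_ : (fun n => pi (u n).1) = fun n => pi (u n).2)//; apply/funext.
Qed.

(** * Upper limits *)

Lemma limn_esup_le_near (R : realType) (v : nat -> \bar R) (c : \bar R) :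
  (\forall n \near \oo, (v n <= c)%E) -> (limn_esup v <= c)%E.
Proof.
move=> vc; apply: (@le_trans _ _ (ereal_sup (v @` [set n | (v n <= c)%E]))).
  by apply: ereal_inf_lbound; exists [set n | (v n <= c)%E].
by apply: ge_ereal_sup => _ [n /= vn <-].
Qed.

Lemma limn_esup_ge (R : realType) (v : nat -> \bar R) (c : \bar R) :
  (forall n, (c <= v n)%E) -> (c <= limn_esup v)%E.
Proof.
move=> cv; apply: le_ereal_inf_tmp => _ [V [N _ VN] <-].
apply: (le_trans (cv N)); apply: ereal_sup_ubound.
by exists N => //; apply: VN => /=.
Qed.

(** * Right translates of Folner sequences *)

Section RightTranslates.
Variable G : groupType.

Definition rtranslate (h : G) (A : {fset G}) : {fset G} :=
  [fset (g * h)%g | g in A]%fset.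

Lemma in_rtranslate (h x : G) (A : {fset G}) :
  (x \in rtranslate h A) = ((x * h^-1)%g \in A).
Proof.
apply/imfsetP/idP => [[y yA ->]|xA]; first by rewrite mulgK.
by exists (x * h^-1)%g => //; rewrite mulgVK.
Qed.

Lemma in_ltranslate (g x : G) (A : {fset G}) :
  (x \in ltranslate g A) = ((g^-1 * x)%g \in A).
Proof.
apply/imfsetP/idP => [[y yA ->]|xA]; first by rewrite mulKg.
by exists (g^-1 * x)%g => //; rewrite mulVKg.
Qed.

Lemma card_rtranslate (h : G) (A : {fset G}) : #|` rtranslate h A| = #|` A|.
Proof. by rewrite card_imfset//; exact: mulIg. Qed.

Lemma fset_symdiff_rtranslate (g h : G) (A : {fset G}) :
  fset_symdiff (rtranslate h A) (ltranslate g (rtranslate h A)) =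
  rtranslate h (fset_symdiff A (ltranslate g A)).
Proof.
apply/fsetP => x.
by rewrite in_rtranslate !(in_fsetU, in_fsetD, in_rtranslate, in_ltranslate) mulgA.
Qed.

(** Left and right translations commute, so a right translation preserves the
    ratios that measure invariance under left translation. *)
Lemma folner_rtranslate (R : realType) (h : G) (F : nat -> {fset G}) :
  folner R F -> folner R (fun n => rtranslate h (F n)).
Proof.
move=> [F0 Finv]; split=> [n|g].
  by rewrite -cardfs_gt0 card_rtranslate cardfs_gt0.
under eq_fun do rewrite fset_symdiff_rtranslate !card_rtranslate.
exact: Finv.
Qed.

End RightTranslates.

(** * The Weyl pseudometric *)

Section Weyl.
Variables (R : realType) (G : groupType) (X : metricType R) (a : G -> X -> X).

Lemma folner_average_le (A : {fset G}) (x x' : X) (c : R) : A != fset0 ->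
  (forall g, mdist (a g x) (a g x') <= c) -> folner_average a A x x' <= c.
Proof.
move=> A0 dc; rewrite /folner_average ler_pdivrMl ?ltr0n ?cardfs_gt0//.
rewrite mulr_natl -iter_addr_0 -[#|` A|]count_predT -big_const_seq.
by apply: ler_sum => g _.
Qed.

Lemma folner_average_ge (A : {fset G}) (x x' : X) (c : R) : A != fset0 ->
  (forall g, c <= mdist (a g x) (a g x')) -> c <= folner_average a A x x'.
Proof.
move=> A0 dc; rewrite /folner_average ler_pdivlMl ?ltr0n ?cardfs_gt0//.
rewrite mulr_natl -iter_addr_0 -[#|` A|]count_predT -big_const_seq.
by apply: ler_sum => g _.
Qed.

Lemma weyl_le (x x' : X) (c : R) :
  (forall g, mdist (a g x) (a g x') <= c) -> (weyl a x x' <= c%:E)%E.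
Proof.
move=> dc; apply: ge_ereal_sup => _ [F [F0 _] <-].
apply: limn_esup_le_near; apply: nearW => n.
by rewrite lee_fin; exact: folner_average_le.
Qed.

Hypothesis amenG : amenable R G.

Lemma weyl_ge (x x' : X) (c : R) :
  (forall g, c <= mdist (a g x) (a g x')) -> (c%:E <= weyl a x x')%E.
Proof.
move=> dc; have [F folF] := amenG.
apply: (@le_trans _ _ (limn_esup (fun n => (folner_average a (F n) x x')%:E))).
  apply: limn_esup_ge => n; rewrite lee_fin.
  by apply: folner_average_ge => //; case: folF.
by apply: ereal_sup_ubound; exists F.
Qed.

Lemma weyl_ge0 (x x' : X) : (0 <= weyl a x x')%E.
Proof. by apply: weyl_ge => g; exact: mdist_ge0. Qed.

Lemma weylxx (x : X) : weyl a x x = 0%E.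
Proof.
apply/eqP; rewrite eq_le weyl_ge0 andbT.
by apply: weyl_le => g; rewrite mdistxx.
Qed.

Hypothesis actX : continuous_action a.

Lemma folner_average_rtranslate (h : G) (A : {fset G}) (x x' : X) :
  folner_average a A (a h x) (a h x') = folner_average a (rtranslate h A) x x'.
Proof.
rewrite /folner_average card_rtranslate; congr (_ * _).
rewrite big_imfset/=; last by move=> ? ? _ _; exact: mulIg.
by apply: eq_bigr => g _; rewrite !(continuous_actionM actX).
Qed.

(** Moving the pair by [h] replaces each average over [A] by the average over
    the right translate of [A] by [h], so the supremum runs over averages along
    Folner sequences again; [h^-1] gives the reverse inequality. *)
Lemma weyl_invariant (h : G) (x x' : X) :
  weyl a (a h x) (a h x') = weyl a x x'.
Proof.
have le k y y' : (weyl a (a k y) (a k y') <= weyl a y y')%E.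
  apply: ge_ereal_sup => _ [F folF <-].
  under eq_fun do rewrite folner_average_rtranslate.
  apply: ereal_sup_ubound; exists (fun n => rtranslate k (F n)) => //.
  exact: folner_rtranslate.
apply/eqP; rewrite eq_le le/=.
have := le h^-1%g (a h x) (a h x').
by rewrite -!(continuous_actionM actX) mulVg !(continuous_action1 actX).
Qed.

End Weyl.

(** * Equicontinuous factor maps *)

Section Equicontinuous.
Variables (R : realType) (G : groupType) (X Y : metricType R).
Variables (a : G -> X -> X) (b : G -> Y -> Y) (pi : X -> Y).
Hypotheses (actX : continuous_action a) (factor_pi : factor_map a b pi).

Lemma fiber_rel_action (g : G) (x x' : X) :
  fiber_rel pi (x, x') -> fiber_rel pi (a g x, a g x').
Proof.
by rewrite /fiber_rel/= !(factor_map_equivariant factor_pi) => ->.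
Qed.

Lemma equicontinuous_orbit_le (eps : R) : equicontinuous_factor a pi ->
    0 < eps -> exists2 delta, 0 < delta &
  forall x x', fiber_rel pi (x, x') -> mdist x x' < delta ->
    forall g, mdist (a g x) (a g x') <= eps.
Proof.
move=> eqpi eps0; have [delta delta0 dP] := eqpi eps eps0.
exists delta => // x x' xx' dxx' g; rewrite -lee_fin.
apply: le_trans (ltW (dP _ _ xx' dxx')).
by apply: ereal_sup_ubound; exists g.
Qed.

(** The modulus of equicontinuity applied at time [g] controls the motion by
    [g^-1], which brings the pair back to its initial position. *)
Lemma equicontinuous_orbit_ge (eps : R) : equicontinuous_factor a pi ->
    0 < eps -> exists2 delta, 0 < delta &
  forall x x', fiber_rel pi (x, x') -> eps < mdist x x' ->
    forall g, delta <= mdist (a g x) (a g x').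
Proof.
move=> eqpi eps0; have [delta delta0 dP] := equicontinuous_orbit_le eqpi eps0.
exists delta => // x x' xx' dxx' g; rewrite leNgt; apply/negP => dg.
have := dP _ _ (fiber_rel_action g xx') dg g^-1%g.
rewrite -!(continuous_actionM actX) mulVg !(continuous_action1 actX).
by rewrite leNgt dxx'.
Qed.

Lemma equicontinuous_distal : equicontinuous_factor a pi -> distal a pi.
Proof.
move=> eqpi x x' xx' /eqP; rewrite -mdist_gt0 => dxx'.
have [delta delta0 dP] : exists2 delta, 0 < delta &
    forall y y', fiber_rel pi (y, y') -> mdist x x' / 2 < mdist y y' ->
    forall g, delta <= mdist (a g y) (a g y').
  by apply: equicontinuous_orbit_ge => //; rewrite divr_gt0.
apply: (@lt_le_trans _ _ delta%:E); first by rewrite lte_fin.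
apply: le_ereal_inf_tmp => _ [g _ <-]; rewrite lee_fin.
by apply: dP => //; lra.
Qed.

Hypothesis amenG : amenable R G.

(** If [D] is below the modulus, then so is the distance at some time, since an
    average cannot fall below all its terms; hence the initial distance was
    small.  Conversely an initially small distance stays small at all times, and
    so do its averages. *)
Lemma equicontinuous_asymptotically_banach_proximalE (u : nat -> X * X)
    (l : X * X) : equicontinuous_factor a pi ->
    (forall n, fiber_rel pi (u n)) -> u n @[n --> \oo] --> l ->
  asymptotically_banach_proximal a u <-> l.1 = l.2.
Proof.
move=> eqpi fu ul; have fu' n : fiber_rel pi ((u n).1, (u n).2) := fu n.
rewrite -(mdist_cvg0_diag ul); split=> [Du|du].
  apply/cvgrPdist_le => eps eps0.
  have [delta delta0 dP] := equicontinuous_orbit_ge eqpi eps0.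
  near=> n.
  rewrite sub0r normrN ger0_norm ?mdist_ge0// leNgt; apply/negP => epsu.
  have : (weyl a (u n).1 (u n).2 < delta%:E)%E.
    near: n; apply: (Du [set y | (y < delta%:E)%E]).
    apply: open_nbhs_nbhs; split; first exact: open_ereal_lt_ereal.
    by rewrite /= lte_fin.
  by rewrite ltNge weyl_ge// => g; exact: dP.
apply: limn_esup_le_cvg => [|n]; last exact: weyl_ge0.
apply/lee_addgt0Pr => eps eps0; rewrite add0e.
have [delta delta0 dP] := equicontinuous_orbit_le eqpi eps0.
apply: limn_esup_le_near; near=> n.
apply: weyl_le; apply: dP => //.
by near: n; exact: cvgr_lt du _ delta0.
Unshelve. all: by end_near. Qed.

Lemma equicontinuous_mean_equicontinuous :
  equicontinuous_factor a pi -> mean_equicontinuous a pi.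
Proof.
move=> eqpi u l fu ul.
have fl := fiber_rel_cvg (factor_map_continuous factor_pi) fu ul.
rewrite (equicontinuous_asymptotically_banach_proximalE eqpi fu ul).
split=> [l12|Dl]; first by rewrite /banach_proximal l12 weylxx.
(* The same criterion, for the constant sequence [l]. *)
apply/(equicontinuous_asymptotically_banach_proximalE eqpi
  (fun=> fl) (cvg_cst l)).
by rewrite /asymptotically_banach_proximal Dl; exact: cvg_cst.
Qed.

End Equicontinuous.

(** * From Banach distality to equicontinuity *)

Section BanachDistal.
Variables (R : realType) (G : groupType) (X Y : metricType R).
Variables (a : G -> X -> X) (b : G -> Y -> Y) (pi : X -> Y).
Hypotheses (actX : continuous_action a) (factor_pi : factor_map a b pi).
Hypothesis amenG : amenable R G.

Lemma distal_banach_distal : distal a pi -> banach_distal a pi.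
Proof.
move=> dpi x x' xx' neq; apply: lt_le_trans (dpi _ _ xx' neq) _.
set m := ereal_inf _.
have lem g : (m <= (mdist (a g x) (a g x'))%:E)%E.
  by apply: ereal_inf_lbound; exists g.
have m0 : (0 <= m)%E := ltW (dpi _ _ xx' neq).
(* [weyl_ge] asks for a real bound. *)
have mfin : m \is a fin_num.
  by rewrite ge0_fin_numE// (le_lt_trans (lem 1%g)) ?ltry.
rewrite -(fineK mfin); apply: weyl_ge => // g.
by rewrite -lee_fin fineK.
Qed.

Lemma not_equicontinuous_separated_sequence : ~ equicontinuous_factor a pi ->
  exists (eps : R) (u : nat -> X * X) (g : nat -> G), 0 < eps /\
    forall n, [/\ fiber_rel pi (u n),
      mdist (u n).1 (u n).2 < n.+1%:R^-1 &
      eps <= mdist (a (g n) (u n).1) (a (g n) (u n).2)].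
Proof.
move=> /existsNP[eps /not_implyP[eps0 noeps]].
(* Half of [eps], since the supremum over [g] need not be attained. *)
exists (eps / 2).
have badn n : exists p : (X * X) * G, [/\ fiber_rel pi p.1,
    mdist p.1.1 p.1.2 < n.+1%:R^-1 &
    eps / 2 <= mdist (a p.2 p.1.1) (a p.2 p.1.2)].
  apply: contrapT => nop; apply: noeps; exists n.+1%:R^-1.
    by rewrite invr_gt0.
  move=> x x' xx' dxx'; apply: (@le_lt_trans _ _ (eps / 2)%:E).
    apply: ge_ereal_sup => _ [g _ <-]; rewrite lee_fin leNgt.
    by apply/negP => /ltW dg; apply: nop; exists (x, x', g).
  by rewrite lte_fin; lra.
have [p pP] := choice badn.
exists (fun n => (p n).1), (fun n => (p n).2); split=> //.
by rewrite divr_gt0.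
Qed.

(** With [v n] the image of [u n] at the time of separation, mean equicontinuity
    is used in both directions: it turns the diagonal limit of [u] into
    [D (u n) -> 0], and [D (v n) -> 0] into Banach proximality of the limit
    of [v]. *)
Lemma banach_distal_equicontinuous : compact [set: X] ->
  mean_equicontinuous a pi -> banach_distal a pi -> equicontinuous_factor a pi.
Proof.
move=> compactX mpi bpi; apply: contrapT.
move=> /not_equicontinuous_separated_sequence[eps [u [g [eps0 ugP]]]].
pose v n := (a (g n) (u n).1, a (g n) (u n).2).
(* One extraction for both sequences, so that they keep common indices. *)
have compactX4 : compact [set: (X * X) * (X * X)].
  by rewrite -!setXTT; do !apply: compact_setX.
have [n [[l m] [len uvlm]]] :=
  compact_cvg_extraction (fun k => (u k, v k)) compactX4.
have ul : u (n k) @[k --> \oo] --> l by exact: cvg_comp uvlm cvg_fst.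
have vm : v (n k) @[k --> \oo] --> m by exact: cvg_comp uvlm cvg_snd.
have fu k : fiber_rel pi (u (n k)) by have [] := ugP (n k).
have fv k : fiber_rel pi (v (n k)).
  by apply: (fiber_rel_action factor_pi); exact: fu.
have l12 : l.1 = l.2.
  apply/(mdist_cvg0_diag ul); apply/cvgrPdist_lt => e e0; near=> k.
  rewrite sub0r normrN ger0_norm ?mdist_ge0//.
  have [_ duk _] := ugP (n k); apply: (lt_trans duk).
  apply: (@le_lt_trans _ _ k.+1%:R^-1).
    by rewrite lef_pV2 ?posrE// ler_nat ltnS.
  by near: k; exact: near_infty_natSinv_lt (PosNum e0).
have Du : asymptotically_banach_proximal a (fun k => u (n k)).
  by apply/(mpi _ _ fu ul); rewrite /banach_proximal l12 weylxx.
have Dv : asymptotically_banach_proximal a (fun k => v (n k)).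
  rewrite /asymptotically_banach_proximal.
  by under eq_fun do rewrite (weyl_invariant actX).
have m12 : m.1 = m.2.
  apply: contrapT => neq; have fm : fiber_rel pi (m.1, m.2).
    exact: fiber_rel_cvg (factor_map_continuous factor_pi) fv vm.
  by have := bpi _ _ fm neq; rewrite ((mpi _ _ fv vm).1 Dv) ltxx.
have : eps <= mdist m.1 m.2.
  apply: cvgr_to_ge (mdist_cvg vm) _; apply: nearW => k.
  by have [] := ugP (n k).
by rewrite m12 mdistxx leNgt eps0.
Unshelve. all: by end_near. Qed.

End BanachDistal.

Theorem theorem9p1 (R : realType) (G : groupType) (X Y : metricType R)
    (a : G -> X -> X) (b : G -> Y -> Y) (pi : X -> Y)
    (countG : countable [set: G]) (amenG : amenable R G)
    (compactX : compact [set: X]) (compactY : compact [set: Y])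
    (actX : continuous_action a) (actY : continuous_action b)
    (factor_pi : factor_map a b pi) :
  [<-> equicontinuous_factor a pi;
       mean_equicontinuous a pi /\ distal a pi;
       mean_equicontinuous a pi /\ banach_distal a pi].
Proof.
tfae=> [eqpi|[mpi dpi]|[mpi bpi]].
- split; last exact: equicontinuous_distal actX factor_pi eqpi.
  exact: equicontinuous_mean_equicontinuous actX factor_pi amenG eqpi.
- by split=> //; exact: distal_banach_distal.
- exact: banach_distal_equicontinuous actX factor_pi amenG compactX mpi bpi.
Qed.
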